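(* Let $(X,\mathcal T)$ be a topological space with $X$ finite. Let $\mathsf{Cov}_{\max}\mathcal T$ be the set of maximal covers of $(X,\mathcal T)$, ordered by refinement: $\mathcal U\le\mathcal W$ iff every $U\in\mathcal U$ is contained in some $W\in\mathcal W$. Then $(\mathsf{Cov}_{\max}\mathcal T,\le)$ is a complete distributive lattice, whose meet and join are given, for all $\mathcal U,\mathcal W\in\mathsf{Cov}_{\max}\mathcal T$, by $$\mathcal U\wedge\mathcal W=\{U\in L_{\mathcal U}\cap L_{\mathcal W}:\ \text{there is no } V\in L_{\mathcal U}\cap L_{\mathcal W}\text{ with } U\subsetneq V\},$$ $$\mathcal U\vee\mathcal W=\{U\in \mathcal U\cup\mathcal W:\ \text{there is no } V\in \mathcal U\cup\mathcal W\text{ with } U\subsetneq V\},$$ where $L_{\mathcal U}\defeq\{U\in\mathcal T:\ \exists V\in\mathcal U,\ U\subseteq V\}$.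
   Context: A cover of $(X,\mathcal T)$ is a family $\mathcal U$ of open sets with $\bigcup\mathcal U=X$. A maximal cover is a cover that is also an antichain with respect to inclusion (for $U,U'\in\mathcal U$, $U\subseteq U'$ implies $U=U'$). *)

(* Defs.v *)
From HB Require Import structures.
From mathcomp Require Import all_boot all_order.
From mathcomp Require Import boolp classical_sets cardinality topology.

Set Implicit Arguments.
Unset Strict Implicit.
Unset Printing Implicit Defensive.

Local Open Scope classical_set_scope.

Definition is_cover (X : topologicalType) (U : set (set X)) : Prop :=
  (forall A, U A -> open A) /\ \bigcup_(A in U) A = setT.

Definition is_antichain (X : Type) (U : set (set X)) : Prop :=
  forall A B, U A -> U B -> A `<=` B -> A = B.

Definition Cov_max (X : topologicalType) : set (set (set X)) :=
  [set U | is_cover U /\ is_antichain U].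
Arguments Cov_max X : clear implicits.

Definition refines (X : Type) (U W : set (set X)) : Prop :=
  forall A, U A -> exists2 B, W B & A `<=` B.

Definition open_downset (X : topologicalType) (U : set (set X)) : set (set X) :=
  [set A | open A /\ exists2 B, U B & A `<=` B].

Definition maximal_sets (X : Type) (F : set (set X)) : set (set X) :=
  [set A | F A /\ ~ (exists2 B, F B & A `<` B)].

(* The supremum and infimum of the empty family are included, so that a
   complete lattice has a least and a greatest element. *)
Definition complete_lattice d (L : latticeType d) : Prop :=
  forall S : set L, supremums S !=set0 /\ infimums S !=set0.

(* Main.v *)
Require Import Defs.
From HB Require Import structures.
From mathcomp Require Import all_boot all_order.
From mathcomp Require Import finmap boolp classical_sets cardinality topology.

Local Open Scope classical_set_scope.

(** Sending a maximal cover U to the open downset L_U is an order embedding, and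
    since X is finite it is onto the covering downsets of open sets: such a
    downset D is L of its family of maximal members. Covering open downsets are
    closed under binary unions and, because each point of the finite space X has a
    least open neighbourhood, under arbitrary intersections; the lattice
    operations are therefore union and intersection, which distribute. *)

(** Induction on the size of the complement of A: either A is maximal in F, or a strictly larger
    member of F has a smaller complement. *)
Lemma maximal_sets_above {T : choiceType} (F : set (set T)) (A : set T) :
  finite_set [set: T] -> F A -> exists2 B, maximal_sets F B & A `<=` B.
Proof.
move=> finT.
have fin (B : set T) : finite_set B by exact: sub_finite_set finT.
have [n] := ubnP (#|` fset_set (~` A)|); elim: n => // n IHn in A *.
rewrite ltnS => leAn FA.
have [[B FB ltAB]|maxA] := pselect (exists2 B, F B & A `<` B); last by exists A.
have [|C maxC BC] := IHn B _ FB.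
  apply: leq_trans leAn; apply: fproper_ltn_card.
  case: ltAB => AB nBA; rewrite fproperE; apply/andP.
  by split; [|apply/negP]; rewrite -fset_set_sub // subsetCP.
by exists C => //; apply: subset_trans BC; case: ltAB.
Qed.

(** N is the complement of a maximal closed set C missing x: if an open B containing x did not
    include N, adjoining the complement of B to C would give a strictly larger closed set missing
    x. *)
Lemma least_open_nbhd {X : topologicalType} (x : X) : finite_set [set: X] ->
  exists N : set X, [/\ open N, N x & forall B, open B -> B x -> N `<=` B].
Proof.
move=> finX.
have [|C [[clC Cx] maxC] _] :=
  @maximal_sets_above X [set C | closed C /\ ~ C x] set0 finX.
  by split=> //; exact: closed0.
exists (~` C); split=> [|//|B oB Bx y Cy]; first exact: closed_openC.
apply: contrapT => By; apply: maxC; exists (C `|` ~` B).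
  by split=> [|[]//]; apply: closedU => //; exact: open_closedC.
by split=> [z|/(_ y)]; [left|move/(_ (or_intror By))].
Qed.

(** * Open downsets generated by families of sets *)

Section OpenDownset.
Context {X : topologicalType}.
Implicit Types F G U W : set (set X).

Lemma refines_open_downset U W : is_cover U ->
  refines U W <-> open_downset U `<=` open_downset W.
Proof.
move=> [oU _]; split=> [UW A [oA [B /UW[C WC BC] AB]]|UW A UA].
  by split=> //; exists C => //; exact: subset_trans BC.
by have [|] := UW A; first by split; [exact: oU|exists A].
Qed.

(** Refinement in both directions places a member A of U inside some B in W, and B inside some C in
    U; the antichain condition gives A = C, which squeezes B to A. *)
Lemma open_downset_inj U W : Cov_max X U -> Cov_max X W ->
  open_downset U = open_downset W -> U = W.
Proof.
wlog suff sub : U W / Cov_max X U -> Cov_max X W ->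
    open_downset U = open_downset W -> U `<=` W.
  by move=> CU CW eUW; apply/seteqP; split; exact: sub.
move=> [cU aU] [cW _] eUW A UA.
have /(_ A UA) [B WB AB] : refines U W by apply/refines_open_downset; rewrite ?eUW.
have /(_ B WB) [C UC BC] : refines W U by apply/refines_open_downset; rewrite ?eUW.
have eAC : A = C by apply: aU => //; exact: subset_trans BC.
by rewrite (_ : A = B) //; apply/seteqP; split; rewrite // eAC.
Qed.

Lemma open_downsetU U W :
  open_downset (U `|` W) = open_downset U `|` open_downset W.
Proof.
apply/seteqP; split=> A.
  by move=> [oA [B [UB|WB] AB]]; [left|right]; split=> //; exists B.
by move=> [] [oA [B ? AB]]; split=> //; exists B => //; [left|right].
Qed.

Lemma open_downset_id F : (forall A, F A -> open A) ->
  (forall A B, open A -> A `<=` B -> F B -> F A) -> open_downset F = F.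
Proof.
move=> oF downF; apply/seteqP; split=> [A [oA [B FB AB]]|A FA].
  exact: downF FB.
by split; [exact: oF|exists A].
Qed.

Lemma open_downsetI U W :
  open_downset (open_downset U `&` open_downset W) =
  open_downset U `&` open_downset W.
Proof.
apply: open_downset_id => [A [[]//]|A B oA AB [[_ [C UC BC]] [_ [D WD BD]]]].
by split; split=> //; [exists C|exists D] => //; exact: subset_trans AB _.
Qed.

(** Every member of F lies below a maximal one, so pruning F to an antichain keeps its downset. *)
Lemma open_downset_maximal_sets F : finite_set [set: X] ->
  open_downset (maximal_sets F) = open_downset F.
Proof.
move=> finX; apply/seteqP; split=> A [oA [B]].
  by move=> [FB _] AB; split=> //; exists B.
move=> /(maximal_sets_above _ _ finX)[C maxC BC] AB.
by split=> //; exists C => //; exact: subset_trans BC.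
Qed.

Lemma Cov_max_maximal_sets F : finite_set [set: X] -> is_cover F ->
  Cov_max X (maximal_sets F).
Proof.
move=> finX [oF covF]; split; [split=> [A [/oF]//|]|].
  apply/seteqP; split=> // x _; have : [set: X] x by [].
  rewrite -covF => -[A /(maximal_sets_above _ _ finX)[B maxB AB] Ax].
  by exists B => //; exact: AB.
move=> A B [FA maxA] [FB _] AB; apply: contrapT => neAB.
by apply: maxA; exists B => //; split=> // BA; apply: neAB; apply/seteqP.
Qed.

Lemma is_cover_setU U W : is_cover U -> is_cover W -> is_cover (U `|` W).
Proof.
move=> [oU cU] [oW cW]; split=> [A [/oU|/oW]//|].
by rewrite bigcup_setU cU setTU.
Qed.

(** A point in A from U and in B from W is covered by the open set A [&] B, which lies below
    both. *)
Lemma is_cover_open_downsetI U W : is_cover U -> is_cover W ->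
  is_cover (open_downset U `&` open_downset W).
Proof.
move=> [oU cU] [oW cW]; split=> [A [[]//]|].
apply/seteqP; split=> // x _; have Tx : [set: X] x by [].
move: (Tx) (Tx); rewrite -{1}cU -cW => -[A UA Ax] [B WB Bx].
have oAB : open (A `&` B) by apply: openI; [exact: oU|exact: oW].
by exists (A `&` B) => //; split; split=> //; [exists A|exists B] => // ? [].
Qed.

(** The least open neighbourhood of x lies below a member of each cover in S. Intersecting with
    [open] matters when S is empty, where the [\bigcap] contains all sets. *)
Lemma is_cover_bigcap_open_downset (S : set (set (set X))) :
  finite_set [set: X] -> (forall U, S U -> is_cover U) ->
  is_cover (open `&` \bigcap_(U in S) open_downset U).
Proof.
move=> finX cS; split=> [A []//|]; apply/seteqP; split=> // x _.
have [N [oN Nx minN]] := least_open_nbhd x finX.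
exists N => //; split=> // U /cS[oU cU].
have : [set: X] x by []; rewrite -cU => -[A UA Ax].
by split=> //; exists A => //; apply: minN => //; exact: oU.
Qed.

End OpenDownset.

(* The display and the finiteness of X are parameters of this alias because the
   canonical lattice structure below depends on them. *)
Definition maxcover (d : Order.disp_t) (X : topologicalType)
  (finX : finite_set [set: X]) : Type := set_type (Cov_max X).

(** * Lattice structure transported along [mcL] *)

Section MaxcoverLattice.
Context (d : Order.disp_t) (X : topologicalType) (finX : finite_set [set: X]).
Notation T := (maxcover d X finX).
Implicit Types U V W : T.

HB.instance Definition _ := SubChoice.on T.

Let mcP U : Cov_max X (val U). Proof. exact: set_mem (valP U). Qed.

Let mcL U := open_downset (val U).

Let mcL_inj : injective mcL.
Proof. by move=> U W eUW; apply/val_inj/open_downset_inj. Qed.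

Let mc_le U W : bool := `[< refines (val U) (val W) >].

Let mc_leE U W : mc_le U W <-> mcL U `<=` mcL W.
Proof.
rewrite -refines_open_downset; last by case: (mcP U).
by split=> /asboolP.
Qed.

Let mc_le_refl : reflexive mc_le. Proof. by move=> U; apply/mc_leE. Qed.

Let mc_le_anti : antisymmetric mc_le.
Proof.
move=> U W /andP[/mc_leE UW /mc_leE WU].
by apply: mcL_inj; apply/seteqP.
Qed.

Let mc_le_trans : transitive mc_le.
Proof.
by move=> U V W /mc_leE VU /mc_leE UW; apply/mc_leE; exact: subset_trans UW.
Qed.

HB.instance Definition _ :=
  Order.Le_isPOrder.Build d T mc_le_refl mc_le_anti mc_le_trans.

Definition maxcover_of {F : set (set X)} (cF : is_cover F) : T :=
  SigSub (mem_set (Cov_max_maximal_sets F finX cF)).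

Let mcL_of F (cF : is_cover F) : mcL (maxcover_of cF) = open_downset F.
Proof. exact: open_downset_maximal_sets. Qed.

Definition maxcover_meet U W : T :=
  maxcover_of (is_cover_open_downsetI _ _ (mcP U).1 (mcP W).1).

Definition maxcover_join U W : T :=
  maxcover_of (is_cover_setU _ _ (mcP U).1 (mcP W).1).

Let mcL_meet U W : mcL (maxcover_meet U W) = mcL U `&` mcL W.
Proof. by rewrite mcL_of open_downsetI. Qed.

Let mcL_join U W : mcL (maxcover_join U W) = mcL U `|` mcL W.
Proof. by rewrite mcL_of open_downsetU. Qed.

Let mc_meetP U V W :
  (U <= maxcover_meet V W)%O = (U <= V)%O && (U <= W)%O.
Proof.
apply/idP/andP => [/mc_leE|[/mc_leE UV /mc_leE UW]].
  by rewrite mcL_meet subsetI => -[? ?]; split; apply/mc_leE.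
by apply/mc_leE; rewrite mcL_meet subsetI.
Qed.

Let mc_joinP U V W :
  (maxcover_join U V <= W)%O = (U <= W)%O && (V <= W)%O.
Proof.
apply/idP/andP => [/mc_leE|[/mc_leE UW /mc_leE VW]].
  by rewrite mcL_join subUset => -[? ?]; split; apply/mc_leE.
by apply/mc_leE; rewrite mcL_join subUset.
Qed.

HB.instance Definition _ :=
  Order.POrder_MeetJoin_isLattice.Build d T mc_meetP mc_joinP.

Let mc_meetUl : left_distributive maxcover_meet maxcover_join.
Proof.
move=> U V W; apply: mcL_inj.
by rewrite mcL_meet !mcL_join !mcL_meet setIUl.
Qed.

HB.instance Definition _ :=
  Order.Lattice_Meet_isDistrLattice.Build d T mc_meetUl.

Lemma maxcover_leP U W : (U <= W)%O <-> refines (val U) (val W).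
Proof. by split=> /asboolP. Qed.

Lemma maxcover_infimum (S : set T) : infimums S !=set0.
Proof.
have cS F : [set val U | U in S] F -> is_cover F.
  by case=> U _ <-; case: (mcP U).
pose I := maxcover_of (is_cover_bigcap_open_downset _ finX cS).
(* The intersection is already downward closed among open sets, so the downset of its maximal
   members is the intersection itself. *)
have LI : mcL I = open `&` \bigcap_(F in [set val U | U in S]) open_downset F.
  rewrite mcL_of; apply: open_downset_id => [A []//|A B oA AB [_ SB]].
  split=> // F /SB [_ [C FC BC]].
  by split=> //; exists C => //; exact: subset_trans BC.
exists I; split=> [U SU|W lbW]; apply/mc_leE; rewrite LI.
  by move=> A [_]; apply; exists U.
move=> A LWA; split; first by case: LWA.
by move=> _ [U SU <-]; have /mc_leE := lbW U SU; apply.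
Qed.

(** A supremum is obtained as the infimum of the set of upper bounds. *)
Lemma maxcover_complete : complete_lattice T.
Proof.
move=> S; split; last exact: maxcover_infimum.
have [I [lbI glbI]] := maxcover_infimum (ubound S).
exists I; split=> // U SU; apply: glbI => W; exact.
Qed.

End MaxcoverLattice.

(* The distributive lattice is a library structure whose carrier is the set
   Cov_max X itself, coerced to the type {U | U \in Cov_max X}. *)
Theorem theorem1 (d : Order.disp_t) (X : topologicalType)
    (finX : finite_set [set: X]) :
  exists c : Order.DistrLattice.axioms_ d (set_type (Cov_max X)),
    let L : distrLatticeType d := Order.DistrLattice.Pack c in
    [/\ forall U W : L, (U <= W)%O <-> refines (val U) (val W),
        complete_lattice L,
        forall U W : L,
          val (Order.meet U W) = maximal_sets (open_downset (val U) `&` open_downset (val W)) &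
        forall U W : L,
          val (Order.join U W) = maximal_sets (val U `|` val W)].
Proof.
exists (Order.DistrLattice.class (maxcover d X finX : distrLatticeType d)).
(* The formulas for meet and join hold by computation, since [maxcover_of] is built on
   [maximal_sets]. *)
split=> //.
- exact: (maxcover_leP d X finX).
- exact: (maxcover_complete d X finX).
Qed.
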